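(* Let $f=\frac1n\sum_{i=1}^n f_i$, let $f$ and the $f_i$ be smooth functions with smoothness constants $L$ and $L_i$ respectively (none assumed convex), let $L_{\max}=\max\{L_i\}_{i=1}^n$, and assume that there exist constants $\rho,\delta>0$ such that $$\mathbb{E}_i[\|\nabla f_i(x)\|^2]\le\rho\,\|\nabla f(x)\|^2+\delta\quad\text{for all }x.$$ Then SGD with $\text{SPS}_{\max}$ with $c>\frac{\rho L}{4L_{\max}}$ and $\gamma_b<\max\left\{\frac{2}{L\rho},\bar\gamma_b\right\}$ converges as $$\min_{k\in[K]}\mathbb{E}\|\nabla f(x^k)\|^2\le\frac{2}{\zeta K}\left(f(x^0)-f(x^* )\right)+\frac{\left(\gamma_b-\alpha+L\gamma_b^2\right)\delta}{\zeta},$$ where $\alpha=\min\left\{\frac{1}{2cL_{\max}},\gamma_b\right\}$, $\zeta=(\gamma_b+\alpha)-\rho\left(\gamma_b-\alpha+L\gamma_b^2\right)$ and $$\bar\gamma_b:=\frac{-(\rho-1)+\sqrt{(\rho-1)^2+\frac{4L\rho(\rho+1)}{2cL_{\max}}}}{2L\rho}.$$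
   Context: The problem is to minimize $f(x)=\frac1n\sum_{i=1}^n f_i(x)$ over $x\in\mathbb{R}^d$. The set of minimizers of $f$ is assumed nonempty and $x^*$ is a minimizer. For each $i$, $f_i^*:=\inf_x f_i(x)$. $\mathbb{E}_i$ is expectation over $i$ uniform in $\{1,\dots,n\}$. It is assumed throughout that $\mathbb{E}_i[f_i(x^* )-f_i^*]=f(x^* )-\mathbb{E}_i[f_i^*]$ is finite. A function is smooth with constant $L$ ($L$-smooth) if its gradient is $L$-Lipschitz. The index set $[K]$ refers to the first $K$ iterates, $k=0,\dots,K-1$. SGD: $x^{k+1}=x^k-\gamma_k\nabla f_i(x^k)$, starting from $x^0$, where at each iteration $k$ the index $i\in\{1,\dots,n\}$ is chosen uniformly at random and $\gamma_k>0$ is the step-size. $\text{SPS}_{\max}$ (bounded stochastic Polyak step-size) with parameters $c>0$ and $\gamma_b>0$: $\gamma_k=\min\left\{\frac{f_i(x^k)-f_i^*}{c\,\|\nabla f_i(x^k)\|^2},\,\gamma_b\right\}$, where $i$ is the index chosen at iteration $k$.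
   Formalization: The bound on γ_b uses min{2/(Lρ), γ̄_b} instead of the printed max: for γ̄_b ≤ γ_b < 2/(Lρ) one has ζ ≤ 0, so the right side is negative or undefined (e.g. f = x²/2, L = L_max = ρ = c = 1, γ_b = 3/2, x⁰ = x* ). L and L_max are taken positive. *)

(* Defs.v *)
From mathcomp Require Import all_boot all_order all_algebra.
From mathcomp Require Import all_classical all_reals all_analysis.

Set Implicit Arguments.
Unset Strict Implicit.
Unset Printing Implicit Defensive.

Import Order.TTheory GRing.Theory Num.Theory.
Import numFieldNormedType.Exports.

Local Open Scope classical_set_scope.
Local Open Scope ring_scope.

(* The library norm `|v| on 'rV[R]_d is the sup norm, so the Euclidean norm is
   defined here; both induce the same notion of differentiability. *)
Definition enorm (R : realType) (d : nat) (v : 'rV[R]_d) : R :=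
  Num.sqrt (\sum_(j < d) v 0 j ^+ 2).

Definition grad (R : realType) (d : nat) (g : 'rV[R]_d -> R) (x : 'rV[R]_d) :
    'rV[R]_d :=
  \row_(j < d) 'D_(delta_mx 0 j) g x.

Definition smooth (R : realType) (d : nat) (L : R) (g : 'rV[R]_d -> R) : Prop :=
  (forall x, differentiable g x) /\
  (forall x y, enorm (grad g x - grad g y) <= L * enorm (x - y)).

Definition avg (R : realType) (n : nat) (a : 'I_n -> R) : R :=
  n%:R^-1 * \sum_(i < n) a i.

Definition avgE (R : realType) (n : nat) (a : 'I_n -> \bar R) : \bar R :=
  ((n%:R^-1)%:E * \sum_(i < n) a i)%E.

(* Extended-real, hence -oo when g is not bounded below. *)
Definition infval (R : realType) (d : nat) (g : 'rV[R]_d -> R) : \bar R :=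
  ereal_inf (range (EFin \o g)).

(* When grad g x = 0 the quotient below is 0 by the convention a / 0 = 0; the
   SGD step is then 0 whatever the step-size. *)
Definition sps_max (R : realType) (d : nat) (c gb : R) (g : 'rV[R]_d -> R)
    (x : 'rV[R]_d) : R :=
  Num.min ((g x - fine (infval g)) / (c * enorm (grad g x) ^+ 2)) gb.

Fixpoint sgd_sps (R : realType) (d n : nat) (c gb : R)
    (f : 'I_n -> 'rV[R]_d -> R) (x0 : 'rV[R]_d) (s : nat -> 'I_n) (k : nat) :
    'rV[R]_d :=
  if k is k'.+1 then
    let x := sgd_sps c gb f x0 s k' in
    x - sps_max c gb (f (s k')) x *: grad (f (s k')) x
  else x0.

Definition iid_uniform (d : measure_display) (T : measurableType d)
    (R : realType) (P : probability T R) (n : nat) (I : nat -> T -> 'I_n) :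
    Prop :=
  [/\ forall k i, measurable (I k @^-1` [set i]),
      forall k i, P (I k @^-1` [set i]) = (n%:R^-1)%:E
    & forall (J : seq nat) (A : nat -> {set 'I_n}), uniq J ->
        P (\bigcap_(k in [set` J]) (I k @^-1` [set` A k])) =
        (\prod_(k <- J) P (I k @^-1` [set` A k]))%E].

(* Main.v *)
Require Import Defs.
From mathcomp Require Import all_boot all_order all_algebra.
From mathcomp Require Import all_classical all_reals all_analysis.
From mathcomp Require Import ring lra.

(** Let [Gi] be the gradient of [fi i] at [x] and [G] that of [f]. Unless [Gi]
    vanishes, in which case it has no effect, the step-size lies between [alpha]
    and [gb]: the upper bound is the truncation, and the lower one holds because a
    gradient step of length [1 / Lmax] already decreases [fi i] by at least
    [|Gi|^2 / (2 Lmax)] ([sps_max_bounds], [smooth_gap]).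

    The descent inequality for [f] along the step [- s Gi] contains the cross term
    [- s <G, Gi>], where [s] is correlated with [Gi]. Polarisation writes it as
    [s / 2 (|Gi - G|^2 - |Gi|^2 - |G|^2)], so that [s] may be replaced by [gb] or
    [alpha] according to signs; what remains is affine in [<G, Gi>] and [|Gi|^2]
    and can be averaged over [i] ([smooth_descent_step]). With the growth
    condition this gives
    [E f (x') <= f x - zeta / 2 |G|^2 + (gb - alpha + L gb^2) delta / 2]
    ([sps_expected_descent]). The two bounds on [gb] make [zeta]
    positive in the two cases of the minimum [alpha]: as a function of [gb], [zeta]
    is a concave quadratic with positive root [2 / (L rho)] when [alpha = gb], and
    [gbar] when [alpha = 1 / (2 c Lmax)] ([zeta_gt0]).

    Telescoping over [K] steps from [f x0] down to at least [f xs], and bounding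
    the minimum by the average, gives the theorem ([mean_min_le]). The telescoping
    is carried out with the finite averages [mean] rather than with integrals, so
    that the integrability of [f] along the iterates need not be discussed; only
    the nonnegative function [|grad f|^2] is integrated, and its expectation is
    identified with [mean] by peeling off the last index
    ([expectation_iterated]). *)

Import Order.TTheory GRing.Theory Num.Theory.
Import numFieldNormedType.Exports.
Set Implicit Arguments.
Unset Strict Implicit.
Unset Printing Implicit Defensive.
Local Open Scope classical_set_scope.
Local Open Scope ring_scope.

(** * Euclidean inner product, gradients and the descent inequality *)

Definition dot {R : realType} {d : nat} (u v : 'rV[R]_d) : R :=
  \sum_(j < d) u 0 j * v 0 j.

Section Dot.
Context {R : realType} {d : nat}.
Implicit Types (a : R) (u v w : 'rV[R]_d).

Lemma dotC u v : dot u v = dot v u.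
Proof. by apply: eq_bigr => j _; rewrite mulrC. Qed.

Lemma dotDl u v w : dot (u + v) w = dot u w + dot v w.
Proof. by rewrite -big_split; apply: eq_bigr => j _; rewrite mxE mulrDl. Qed.

Lemma dotZl a u v : dot (a *: u) v = a * dot u v.
Proof. by rewrite mulr_sumr; apply: eq_bigr => j _; rewrite mxE mulrA. Qed.

Lemma dotNl u v : dot (- u) v = - dot u v.
Proof. by rewrite -scaleN1r dotZl mulN1r. Qed.

Lemma dotBl u v w : dot (u - v) w = dot u w - dot v w.
Proof. by rewrite dotDl dotNl. Qed.

Lemma dotDr u v w : dot u (v + w) = dot u v + dot u w.
Proof. by rewrite dotC dotDl !(dotC _ u). Qed.

Lemma dotZr a u v : dot u (a *: v) = a * dot u v.
Proof. by rewrite dotC dotZl dotC. Qed.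

Lemma dotNr u v : dot u (- v) = - dot u v.
Proof. by rewrite dotC dotNl dotC. Qed.

Lemma dot_ge0 u : 0 <= dot u u.
Proof. by apply: sumr_ge0 => j _; rewrite -expr2 sqr_ge0. Qed.

Lemma dot_eq0 u : dot u u = 0 -> u = 0.
Proof.
move=> u0; apply/rowP => j; rewrite mxE; apply/eqP.
have sq_ge0 (i : 'I_d) : xpredT i -> 0 <= u 0 i * u 0 i.
  by rewrite -expr2 sqr_ge0.
by have /eqP := psumr_eq0P sq_ge0 u0 (i := j) isT; rewrite mulf_eq0 orbb.
Qed.

Lemma enorm_sqr u : enorm u ^+ 2 = dot u u.
Proof.
rewrite /enorm sqr_sqrtr; last by apply: sumr_ge0 => j _; exact: sqr_ge0.
by apply: eq_bigr => j _; rewrite expr2.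
Qed.

Lemma enorm_ge0 u : 0 <= enorm u.
Proof. exact: sqrtr_ge0. Qed.

(** The expansion of the square of [u - s v]. When [|u| <= s |v|] it yields
    [<u, v> <= s |v|^2], which is all that Cauchy-Schwarz would give in the
    descent inequality. *)
Lemma dot_young s u v : 0 < s -> dot u v <= (dot u u / s + s * dot v v) / 2.
Proof.
move=> s0; have := dot_ge0 (u - s *: v).
rewrite !(dotDl, dotDr, dotNl, dotNr, dotZl, dotZr) (dotC v u) => h.
rewrite -(ler_pM2l s0).
have -> : s * ((dot u u / s + s * dot v v) / 2) =
  (dot u u + s ^+ 2 * dot v v) / 2 by field; rewrite gt_eqF.
nra.
Qed.

End Dot.

Section Gradient.
Context {R : realType} {d : nat}.
Implicit Types (g : 'rV[R]_d -> R) (x y v : 'rV[R]_d).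

Lemma derive_grad g x v :
  differentiable g x -> 'D_v g x = dot (grad g x) v.
Proof.
move=> dg; rewrite deriveE // {1}(row_sum_delta v) linear_sum /=.
by apply: eq_bigr => j _; rewrite linearZ /= mxE deriveE // mulrC.
Qed.

(** Moving the base point along a line and differentiating in the direction of
    that line are the same difference quotient, so no chain rule is involved. *)
Lemma is_derive_line g x v (t : R) :
  differentiable g (x + t *: v) ->
  is_derive t 1 (fun s => g (x + s *: v)) (dot (grad g (x + t *: v)) v).
Proof.
move=> dg; have dv := diff_derivable (v := v) dg.
have shift (h : R) : x + (h *: (1 : R) + t) *: v = h *: v + (x + t *: v).
  by rewrite scalerDl [h *: 1]mulr1 addrCA.
rewrite -derive_grad //; apply: DeriveDef.
  by rewrite /derivable; under eq_fun do rewrite /= shift.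
by rewrite /derive; under eq_fun do rewrite /= shift.
Qed.

Lemma smooth_sqr L g x y : 0 < L -> smooth L g ->
  dot (grad g x - grad g y) (grad g x - grad g y) <=
  L ^+ 2 * dot (x - y) (x - y).
Proof.
move=> L0 [_ /(_ x y) Lg]; rewrite -!enorm_sqr -exprMn.
by rewrite ler_pXn2r // nnegrE ?mulr_ge0 ?enorm_ge0 // ltW.
Qed.

Lemma smooth_le L M g : L <= M -> smooth L g -> smooth M g.
Proof.
move=> LM [dg Lg]; split=> // x y; apply: le_trans (Lg x y) _.
by rewrite ler_wpM2r // enorm_ge0.
Qed.

(** Subtract from [t |-> g (x + t v)] the quadratic that the inequality predicts.
    The derivative of the difference at [t] is
    [<grad g (x + t v) - grad g x, v> - L t |v|^2], which is nonpositive for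
    [t >= 0] by the Lipschitz bound, so the mean value theorem on [0, 1] gives
    the claim. *)
Lemma smooth_descent L g x v : 0 < L -> smooth L g ->
  g (x + v) <= g x + dot (grad g x) v + L / 2 * dot v v.
Proof.
move=> L0 Lg; have dg := Lg.1.
pose G t := grad g (x + t *: v).
pose phi (t : R) := g (x + t *: v)
  - (t * dot (grad g x) v + t ^+ 2 * (L / 2 * dot v v)).
pose dphi (t : R) := dot (G t) v - (dot (grad g x) v + t * (L * dot v v)).
have phiP (t : R) : is_derive t 1 phi (dphi t).
  have ? := is_derive_line (dg (x + t *: v)).
  by apply: is_derive_eq; rewrite /dphi -/(G t) /GRing.scale /=; field.
have phi_cont : {within `[0, 1], continuous phi}.
  by apply: derivable_within_continuous => t _; have [] := phiP t.
have [t] := MVT_segment ler01 (fun t _ => phiP t) phi_cont.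
rewrite in_itv /= => /andP[t0 t1]; rewrite subr0 mulr1 => phiE.
have dphi_le0 : dphi t <= 0.
  have [->|tn0] := eqVneq t 0.
    by rewrite /dphi /G scale0r addr0; lra.
  (* Young's inequality with weight [L t], for which both halves of its bound
     are at most [L t |v|^2 / 2]. *)
  have tgt0 : 0 < t by rewrite lt_def tn0.
  have Lt0 : 0 < L * t by rewrite mulr_gt0.
  have := dot_young (G t - grad g x) v Lt0.
  have := smooth_sqr (x + t *: v) x L0 Lg; rewrite -/(G t).
  rewrite addrAC subrr add0r dotZl dotZr => GL.
  have : dot (G t - grad g x) (G t - grad g x) / (L * t) <= L * t * dot v v.
    rewrite ler_pdivrMr //; apply: le_trans GL _; rewrite le_eqVlt.
    by apply/orP; left; apply/eqP; ring.
  rewrite (dotBl _ _ v) /dphi; lra.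
move: phiE; rewrite /phi scale1r scale0r addr0 expr1n expr0n /= => phiE; lra.
Qed.

Lemma grad_avg n (F : 'I_n -> 'rV[R]_d -> R) x v :
  (forall i, differentiable (F i) x) ->
  dot (grad (fun y => avg (fun i => F i y)) x) v =
  avg (fun i => dot (grad (F i) x) v).
Proof.
move=> dF.
have -> : (fun y => avg (fun i => F i y)) = n%:R^-1 \*: (\sum_(i < n) F i).
  by apply/funext => y; rewrite /avg /= fct_sumE.
have dsum : differentiable (\sum_(i < n) F i) x by exact: differentiable_sum.
rewrite -derive_grad; last exact: differentiableZ.
rewrite deriveZ; last exact: diff_derivable.
rewrite derive_sum; last by move=> i; exact: diff_derivable.
by congr (_ * _); apply: eq_bigr => i _; rewrite derive_grad.
Qed.

Lemma infval_lbound g x : infval g \is a fin_num -> fine (infval g) <= g x.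
Proof.
move=> gfin; rewrite -lee_fin fineK //.
by apply: ereal_inf_lbound; exists x.
Qed.

(** A gradient step of length [1 / M] decreases [g] by at least
    [|grad g x|^2 / (2 M)], and cannot go below the infimum. This is what keeps
    the Polyak step-size away from zero. *)
Lemma smooth_gap M g x : 0 < M -> smooth M g -> infval g \is a fin_num ->
  dot (grad g x) (grad g x) / (2 * M) <= g x - fine (infval g).
Proof.
move=> M0 Mg gfin.
have := infval_lbound (x + (- M^-1) *: grad g x) gfin.
have := smooth_descent x ((- M^-1) *: grad g x) M0 Mg.
rewrite !(dotZl, dotZr).
set q := dot _ _.
have -> : q / (2 * M) = M^-1 * q / 2 by field; rewrite gt_eqF.
have -> : M / 2 * (- M^-1 * (- M^-1 * q)) = M^-1 * q / 2
  by field; rewrite gt_eqF.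
lra.
Qed.

End Gradient.

(** * Iterating uniformly chosen maps *)

Section Average.
Context {R : realType} {n : nat}.
Implicit Types a b : 'I_n -> R.

Lemma avg_le a b : (forall i, a i <= b i) -> avg a <= avg b.
Proof.
by move=> ab; rewrite ler_wpM2l ?invr_ge0 ?ler0n //; exact: ler_sum.
Qed.

Lemma avgD a b : avg (fun i => a i + b i) = avg a + avg b.
Proof. by rewrite /avg big_split mulrDr. Qed.

Lemma avgZ (r : R) a : avg (fun i => r * a i) = r * avg a.
Proof. by rewrite /avg -mulr_sumr mulrCA. Qed.

Lemma avg_cst (r : R) : (0 < n)%N -> avg (fun _ : 'I_n => r) = r.
Proof.
move=> n0; rewrite /avg sumr_const card_ord -[r *+ n]mulr_natl mulrA.
by rewrite mulVf ?mul1r // pnatr_eq0 -lt0n.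
Qed.

End Average.

Section RandomIteration.
Context {R : realType} {n : nat} {X : Type} (step : 'I_n -> X -> X) (x0 : X).
Implicit Types (F G : X -> R) (k : nat).

Fixpoint iterated (s : nat -> 'I_n) k : X :=
  if k is k'.+1 then step (s k') (iterated s k') else x0.

(** The [k]-step transition operator of the chain, applied to [F] at [x0]: the
    value that the expectation of [F] at step [k] takes when the indices are
    independent and uniform. Only finitely many index words occur, so no
    integrability question arises for it, even when [F] changes sign. The last
    step is averaged first, as [iterated] applies it last. *)
Fixpoint mean k F : R :=
  if k is k'.+1 then mean k' (fun x => avg (fun i => F (step i x))) else F x0.

Lemma mean_le k F G : (forall x, F x <= G x) -> mean k F <= mean k G.
Proof.
by elim: k F G => [|k IHk] F G FG //=; apply: IHk => x; exact: avg_le.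
Qed.

Lemma meanD k F G : mean k (fun x => F x + G x) = mean k F + mean k G.
Proof.
elim: k F G => [//|k IHk] F G /=; rewrite -IHk; congr mean.
by apply/funext => x; rewrite avgD.
Qed.

Lemma meanZ k (r : R) F : mean k (fun x => r * F x) = r * mean k F.
Proof.
elim: k F => [//|k IHk] F /=; rewrite -IHk; congr mean.
by apply/funext => x; rewrite avgZ.
Qed.

Lemma mean_cst k (r : R) : (0 < n)%N -> mean k (fun=> r) = r.
Proof.
move=> n0; elim: k => [//|k IHk] /=; rewrite -[RHS]IHk; congr mean.
by apply/funext => x; rewrite avg_cst.
Qed.

Lemma mean_sum k (F : 'I_n -> X -> R) :
  mean k (fun x => \sum_(i < n) F i x) = \sum_(i < n) mean k (F i).
Proof.
elim: k F => [//|k IHk] F /=; rewrite -IHk; congr mean; apply/funext => x.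
by rewrite /avg exchange_big /= mulr_sumr.
Qed.

Lemma mean_avg k (F : 'I_n -> X -> R) :
  mean k (fun x => avg (fun i => F i x)) = avg (fun i => mean k (F i)).
Proof. by rewrite meanZ mean_sum. Qed.

End RandomIteration.

(** * The expectation along independent uniform indices *)

Section Law.
Context {R : realType} {disp : measure_display} {T : measurableType disp}.
Context (P : probability T R) {n : nat} (I : nat -> T -> 'I_n).
Context (iid : iid_uniform P I).

Lemma measurable_index k (B : set 'I_n) : measurable (I k @^-1` B).
Proof.
have -> : I k @^-1` B = \bigcup_(i in B) (I k @^-1` [set i]).
  apply/seteqP; split => [w Bw|w [i Bi /= Ikw]]; last by rewrite /= Ikw.
  by exists (I k w).
apply: fin_bigcup_measurable => [|i _]; first exact: finite_finset.
by have [mI _ _] := iid; exact: mI.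
Qed.

(** The events to which the independence hypothesis assigns a product
    probability. *)
Definition cylinder (J : seq nat) (A : nat -> {set 'I_n}) : set T :=
  \bigcap_(k in [set` J]) (I k @^-1` [set` A k]).

Lemma measurable_cylinder J A : measurable (cylinder J A).
Proof.
by apply: fin_bigcap_measurable => [|k _];
  [exact: finite_seq|exact: measurable_index].
Qed.

Lemma cylinder_nil A : cylinder [::] A = setT.
Proof. by apply/seteqP; split. Qed.

(** Overriding the constraint at [k] turns the intersection of a cylinder with
    [I k = i] into another cylinder. *)
Definition prescribe k (i : 'I_n) (A : nat -> {set 'I_n}) j : {set 'I_n} :=
  if j == k then [set i]%SET else A j.

Lemma cylinder_consP k J A i w : k \notin J ->
  cylinder (k :: J) (prescribe k i A) w <-> I k w = i /\ cylinder J A w.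
Proof.
move=> kJ; split => [Cw|[Iki Cw] j /=].
  split.
    by have := Cw k (mem_head _ _); rewrite /= /prescribe eqxx inE => /eqP.
  move=> j /= jJ; have := Cw j; rewrite /= /prescribe inE jJ orbT => /(_ isT).
  by case: eqP => // jk; rewrite -jk jJ in kJ.
rewrite /prescribe inE; have [->|jk] /= := eqVneq j k; first by rewrite inE Iki.
exact: Cw.
Qed.

Lemma prob_cylinder_cons k J A i : uniq J -> k \notin J ->
  P (cylinder (k :: J) (prescribe k i A)) = ((n%:R^-1)%:E * P (cylinder J A))%E.
Proof.
move=> uJ kJ; have [_ unif indep] := iid.
rewrite /cylinder indep /= ?kJ // indep // big_cons; congr (_ * _)%E.
  rewrite -(unif k i); congr (P _); apply/seteqP.
  by split => w /=; rewrite /prescribe eqxx inE => /eqP.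
apply: eq_big_seq => j jJ; rewrite /prescribe; case: eqP => // jk.
by rewrite -jk jJ in kJ.
Qed.

Context {X : Type} (step : 'I_n -> X -> X) (x0 : X).
Let walk k w := iterated step x0 (I^~ w) k.

(** The first [k] indices take finitely many values, so every subset of the
    state space, which carries no sigma-algebra, has a measurable preimage. *)
Lemma measurable_walk k (B : set X) : measurable (walk k @^-1` B).
Proof.
elim: k B => [|k IHk] B.
  have [Bx0|Bx0] := pselect (B x0).
    by rewrite (_ : _ @^-1` _ = setT) //; apply/seteqP; split.
  by rewrite (_ : _ @^-1` _ = set0) //; apply/seteqP; split.
have -> : walk k.+1 @^-1` B =
    \bigcup_(i in [set: 'I_n]) (I k @^-1` [set i] `&` walk k @^-1` (step i @^-1` B)).
  apply/seteqP; split => [w Bw|w [i _ [/= Ikw Bw]]]; last by rewrite /walk /= Ikw.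
  by exists (I k w).
apply: fin_bigcup_measurable => [|i _]; first exact: finite_finset.
by apply: measurableI; [exact: measurable_index|exact: IHk].
Qed.

(** Restricting to cylinders over indices at least [k] is what makes the
    induction close: conditioning on the last index [I k] of the walk adds one
    constraint to the cylinder, and the shorter walk still only involves earlier
    indices. *)
Lemma integral_walk k (F : X -> R) J A :
  (forall x, 0 <= F x) -> uniq J -> {in J, forall j, (k <= j)%N} ->
  (\int[P]_(w in cylinder J A) (F (walk k w))%:E =
   P (cylinder J A) * (mean step x0 k F)%:E)%E.
Proof.
elim: k F J A => [|k IHk] F J A F0 uJ leJ.
  by rewrite (integral_cst P (measurable_cylinder J A) (F x0)%:E) muleC.
have kJ : k \notin J by apply/negP => /leJ; rewrite ltnn.
have FE i (w : T) : I k w = i -> F (walk k.+1 w) = F (step i (walk k w)).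
  by rewrite /walk /= => ->.
pose C i := cylinder (k :: J) (prescribe k i A).
have mC i : measurable (C i) by exact: measurable_cylinder.
have disjC : trivIset [set` index_enum 'I_n] C.
  move=> i j _ _ [w [Ci Cj]].
  have [<- _] := (cylinder_consP A i w kJ).1 Ci.
  by have [<- _] := (cylinder_consP A j w kJ).1 Cj.
have cylE : cylinder J A = \big[setU/set0]_(i < n) C i.
  rewrite -bigcup_seq; apply/seteqP; split => [w Cw|w [i _]].
    exists (I k w); first by rewrite /= mem_index_enum.
    exact/cylinder_consP.
  by move=> /cylinder_consP -/(_ kJ)[].
rewrite [in LHS]cylE ge0_integral_bigsetU //; last 3 first.
- exact: index_enum_uniq.
- move=> mD Y mY; apply: measurableI => //.
  exact: (measurable_walk k.+1 (fun x => Y (F x)%:E)).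
- by move=> w _; rewrite lee_fin.
have [p pE] : exists p, P (cylinder J A) = p%:E.
  exists (fine (P (cylinder J A))); rewrite fineK //.
  exact: fin_num_measure (measurable_cylinder J A).
rewrite /= mean_avg pE -EFinM /avg mulrCA !mulr_sumr -sumEFin.
apply: eq_bigr => i _.
transitivity (\int[P]_(w in C i) (F (step i (walk k w)))%:E)%E.
  apply: eq_integral => w /set_mem Ciw; rewrite (FE i) //.
  by have [] := (cylinder_consP A i w kJ).1 Ciw.
rewrite (IHk (F \o step i)) //; last 3 first.
- by move=> x; exact: F0.
- by rewrite /= kJ.
- by move=> j; rewrite inE => /predU1P[->//|/leJ/ltnW].
by rewrite prob_cylinder_cons // pE -!EFinM mulrA.
Qed.

Lemma expectation_iterated k (F : X -> R) : (forall x, 0 <= F x) ->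
  ('E_P[fun w => F (iterated step x0 (I^~ w) k)] = (mean step x0 k F)%:E)%E.
Proof.
move=> F0; rewrite unlock -(cylinder_nil (fun=> finset.set0)).
rewrite (integral_walk (k := k) _ F0) //.
by rewrite cylinder_nil probability_setT mul1e.
Qed.

End Law.

(** * One step of the method *)

Section Step.
Context {R : realType} {d : nat}.

(** The gaps [F i xs - inf (F i)] are nonnegative, so one infinite gap would make
    their average infinite. *)
Lemma infval_fin_num n (F : 'I_n -> 'rV[R]_d -> R) xs : (0 < n)%N ->
  avgE (fun i => (F i xs)%:E - infval (F i))%E \is a fin_num ->
  forall i, infval (F i) \is a fin_num.
Proof.
move=> n0 avgfin.
have gap_ge0 i : (0 <= (F i xs)%:E - infval (F i))%E.
  rewrite sube_ge0; last by rewrite orbT.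
  by apply: ereal_inf_lbound; exists xs.
have gapNy i : ((F i xs)%:E - infval (F i))%E != -oo%E.
  by rewrite gt_eqF // (lt_le_trans _ (gap_ge0 i)) // ltNyr.
have sum_ge0 : (0 <= \sum_(i < n) ((F i xs)%:E - infval (F i)))%E.
  by apply: sume_ge0 => i _; exact: gap_ge0.
have /sum_fin_numP gapfin :
    (\sum_(i < n) ((F i xs)%:E - infval (F i)))%E \is a fin_num.
  rewrite ge0_fin_numE // ltey; apply/eqP => sumy.
  by move: avgfin; rewrite /avgE sumy gt0_muley // lte_fin invr_gt0 ltr0n.
move=> i; have := gapfin i (mem_index_enum i) isT.
by rewrite fin_numB => /andP[].
Qed.

(** The upper bound is the truncation and the lower bound is [smooth_gap]. At a
    stationary point of [g] the quotient in the step-size degenerates, but any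
    step-size in the range then yields the same (null) step. *)
Lemma sps_max_bounds c gb M (g : 'rV[R]_d -> R) x :
  let alpha := Num.min (1 / (2 * c * M)) gb in
  0 < c -> 0 < gb -> 0 < M -> smooth M g -> infval g \is a fin_num ->
  exists2 s, alpha <= s <= gb &
    x - sps_max c gb g x *: grad g x = x - s *: grad g x.
Proof.
move=> alpha c0 gb0 M0 Mg gfin.
have alphagb : alpha <= gb by rewrite ge_min lexx orbT.
have [g0|gn0] := eqVneq (grad g x) 0.
  by exists gb; [rewrite alphagb lexx|rewrite g0 !scaler0].
exists (sps_max c gb g x) => //; apply/andP; split; last first.
  by rewrite ge_min lexx orbT.
have q0 : 0 < dot (grad g x) (grad g x).
  rewrite lt_def dot_ge0 andbT; apply: contra gn0 => /eqP /dot_eq0 ->.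
  by rewrite eqxx.
rewrite /sps_max enorm_sqr le_min alphagb andbT.
apply: (@le_trans _ _ (1 / (2 * c * M))); first by rewrite ge_min lexx.
rewrite ler_pdivlMr ?mulr_gt0 //; apply: le_trans (smooth_gap x M0 Mg gfin).
rewrite le_eqVlt; apply/orP; left; apply/eqP; field.
by rewrite !gt_eqF.
Qed.

(** The step-size depends on the sampled function, so it must be replaced by
    constants before averaging. Writing
    [- s <G, u> = s / 2 (|u - G|^2 - |u|^2 - |G|^2)] with [G = grad g x], the
    nonnegative square takes the upper bound [b] of [s] and the negative ones its
    lower bound [a]. *)
Lemma smooth_descent_step L g (u : 'rV[R]_d) x a b s : 0 < L -> smooth L g ->
  0 <= s -> a <= s <= b ->
  g (x - s *: u) <= g x + (b - a + L * b ^+ 2) / 2 * dot u u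
    + ((b - a) / 2 * dot (grad g x) (grad g x) - b * dot (grad g x) u).
Proof.
move=> L0 Lg s0 /andP[as_ sb].
have := smooth_descent x (- (s *: u)) L0 Lg.
rewrite !(dotNl, dotNr, dotZl, dotZr) opprK.
have := dot_ge0 (u - grad g x); have := dot_ge0 u; have := dot_ge0 (grad g x).
rewrite !(dotBl, dotDr, dotNr) (dotC u (grad g x)).
set U := dot u u; set G := dot (grad g x) (grad g x); set W := dot _ u.
move=> G0 U0 D0 h; apply: le_trans h _.
have h1 : 0 <= (b - s) * (U - W - (W - G)) by rewrite mulr_ge0 ?subr_ge0 //; lra.
have h2 : 0 <= (s - a) * (U + G) by rewrite mulr_ge0 ?subr_ge0 ?addr_ge0.
have h3 : L * s ^+ 2 * U <= L * b ^+ 2 * U.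
  rewrite ler_wpM2r // ler_wpM2l ?(ltW L0) // ler_pXn2r // nnegrE //.
  exact: le_trans sb.
nra.
Qed.

End Step.

(** When [b < a] the claim is the bound [b < 2 / (L rho)]. Otherwise the quantity
    is a concave quadratic in [b] with discriminant [D] and positive constant term
    [(rho + 1) a], hence positive for [b] between [0] and its positive root, which
    is the other bound. *)
Lemma zeta_gt0 (R : rcfType) (L rho a b : R) :
  0 < L -> 0 < rho -> 0 < a -> 0 < b ->
  b < 2 / (L * rho) ->
  b < (- (rho - 1) + Num.sqrt ((rho - 1) ^+ 2 + 4 * L * rho * (rho + 1) * a))
        / (2 * L * rho) ->
  0 < (b + Num.min a b) - rho * (b - Num.min a b + L * b ^+ 2).
Proof.
move=> L0 rho0 a0 b0; rewrite !ltr_pdivlMr ?mulr_gt0 // => b1 b2.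
have [ab|ba] := leP a b; last by nra.
set D := (rho - 1) ^+ 2 + _ in b2.
have D0 : 0 <= D by rewrite addr_ge0 ?sqr_ge0 // !mulr_ge0 //; lra.
have sD := sqr_sqrtr D0; have sD0 := sqrtr_ge0 D.
(* [t] is [- q' (b)] for the quadratic [q] at stake, and
   [4 L rho q (b) = D - t ^+ 2]. *)
set t := 2 * L * rho * b + (rho - 1).
have tD : t < Num.sqrt D by rewrite /t; lra.
have tN : - Num.sqrt D < t.
  have rho1 : `|rho - 1| <= Num.sqrt D.
    rewrite -sqrtr_sqr ler_sqrt // lerDl !mulr_ge0 //; lra.
  have := ler_norm (- (rho - 1)); rewrite normrN => rhoN.
  have : 0 < 2 * L * rho * b by rewrite !mulr_gt0.
  by rewrite /t; lra.
have tDD : t ^+ 2 < D by rewrite -sD; nra.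
have Lrho : 0 < 4 * L * rho by rewrite !mulr_gt0.
rewrite -(pmulr_rgt0 _ Lrho); move: tDD; rewrite /t /D -subr_gt0.
by congr (0 < _); ring.
Qed.

(** Averaging the one-step inequality over the law of the [k]-th iterate and
    telescoping bounds the sum of the first [K] means of [h], hence [K] times the
    smallest of them. *)
Lemma mean_min_le (R : realType) n X (step : 'I_n -> X -> X) (x0 : X)
    (f h : X -> R) (m z B : R) K :
  (0 < n)%N -> (0 < K)%N -> 0 < z -> (forall x, m <= f x) ->
  (forall x, avg (fun i => f (step i x)) <= f x - z / 2 * h x + B / 2) ->
  exists k : 'I_K,
    mean step x0 k h <= 2 / (z * K%:R) * (f x0 - m) + B / z.
Proof.
move=> n0 K0 z0 mf descent; set bnd := _ + _.
have mean_descent k : mean step x0 k.+1 f <=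
    mean step x0 k f - z / 2 * mean step x0 k h + B / 2.
  apply: le_trans (mean_le step x0 k descent) _.
  by rewrite meanD meanD mean_cst // -mulNr -meanZ;
    under [in leRHS]eq_fun do rewrite mulNr.
have telescope k : z / 2 * \sum_(j < k) mean step x0 j h <=
    f x0 - mean step x0 k f + k%:R * (B / 2).
  elim: k => [|k IHk]; first by rewrite big_ord0 mulr0 mul0r addr0 subrr.
  by rewrite big_ord_recr mulrDr -(natr1 k) /=; have := mean_descent k; lra.
have [k _ kmin] := @arg_minP _ _ _ (Ordinal K0) xpredT
  (fun j : 'I_K => mean step x0 j h) isT.
exists k.
have K0R : 0 < K%:R :> R by rewrite ltr0n.
have sum_ge : K%:R * mean step x0 k h <= \sum_(j < K) mean step x0 j h.
  rewrite mulr_natl -[K in _ *+ K]card_ord -sumr_const.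
  by apply: ler_sum => j _; exact: kmin.
have mK : m <= mean step x0 K f.
  by rewrite -(mean_cst step x0 K m n0); exact: mean_le.
have zK0 : 0 < z * K%:R / 2 by rewrite !mulr_gt0.
rewrite -(ler_pM2l zK0).
have -> : z * K%:R / 2 * bnd = f x0 - m + K%:R * (B / 2).
  by rewrite /bnd; field; rewrite !gt_eqF.
have -> : z * K%:R / 2 * mean step x0 k h = z / 2 * (K%:R * mean step x0 k h).
  by ring.
have z20 : 0 < z / 2 by rewrite divr_gt0.
have := telescope K.
have : z / 2 * (K%:R * mean step x0 k h) <=
    z / 2 * \sum_(j < K) mean step x0 j h by rewrite ler_pM2l.
lra.
Qed.

Section ExpectedDescent.
Context (R : realType) (d n : nat) (fi : 'I_n -> 'rV[R]_d -> R).
Context (L M rho delta c gb : R).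
Let f x := avg (fun i => fi i x).
Let alpha := Num.min (1 / (2 * c * M)) gb.

(** Averaging [smooth_descent_step] over the index: the cross term averages to
    [|grad f x|^2] because the gradient of [f] is the average of the gradients,
    and the growth condition controls the mean square of the gradients. *)
Lemma sps_expected_descent x : (0 < n)%N ->
  0 < L -> 0 < M -> 0 < c -> 0 < gb -> smooth L f ->
  (forall i, smooth M (fi i)) -> (forall i, infval (fi i) \is a fin_num) ->
  avg (fun i => enorm (grad (fi i) x) ^+ 2) <= rho * enorm (grad f x) ^+ 2 + delta ->
  let noise := gb - alpha + L * gb ^+ 2 in
  avg (fun i => f (x - sps_max c gb (fi i) x *: grad (fi i) x)) <=
  f x - (gb + alpha - rho * noise) / 2 * enorm (grad f x) ^+ 2
    + noise * delta / 2.
Proof.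
move=> n0 L0 M0 c0 gb0 Lf Mfi fifin; under eq_fun do rewrite enorm_sqr.
rewrite enorm_sqr => growth /=; set noise := gb - alpha + _.
move: growth; set G := grad f x => growth.
have alpha0 : 0 < alpha by rewrite lt_min gb0 andbT divr_gt0 ?mulr_gt0.
have noise0 : 0 <= noise.
  by rewrite addr_ge0 ?subr_ge0 ?ge_min ?lexx ?orbT ?mulr_ge0 ?sqr_ge0 ?ltW.
have each i : f (x - sps_max c gb (fi i) x *: grad (fi i) x) <=
    noise / 2 * dot (grad (fi i) x) (grad (fi i) x)
    + (- gb * dot (grad (fi i) x) G + (f x + (gb - alpha) / 2 * dot G G)).
  have [s sbd ->] := sps_max_bounds x c0 gb0 M0 (Mfi i) (fifin i).
  have s0 : 0 <= s by case/andP: sbd => /(le_trans (ltW alpha0)).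
  have := smooth_descent_step (grad (fi i) x) x L0 Lf s0 sbd.
  by rewrite -/G -/alpha -/noise (dotC G); lra.
apply: le_trans (avg_le each) _.
have GG : avg (fun i => dot (grad (fi i) x) G) = dot G G.
  by rewrite -grad_avg // => i; have [] := Mfi i.
rewrite avgD avgZ avgD avgZ avg_cst // GG.
have : noise / 2 * avg (fun i => dot (grad (fi i) x) (grad (fi i) x)) <=
    noise / 2 * (rho * dot G G + delta) by rewrite ler_wpM2l // divr_ge0.
lra.
Qed.

End ExpectedDescent.

(** * Convergence *)

Lemma sgd_spsE (R : realType) (d n : nat) (c gb : R)
    (fi : 'I_n -> 'rV[R]_d -> R) x0 s k :
  sgd_sps c gb fi x0 s k =
  iterated (fun i x => x - sps_max c gb (fi i) x *: grad (fi i) x) x0 s k.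
Proof. by elim: k => [//|k IHk] /=; rewrite IHk. Qed.

(* The step-size bound is the minimum of the two thresholds: between them
   (gbar <= gb < 2 / (L * rho)) one has zeta <= 0 and the bound fails. *)
Theorem theorem3p8 (R : realType) (disp : measure_display)
    (T : measurableType disp) (P : probability T R) (d n : nat)
    (fi : 'I_n -> 'rV[R]_d -> R) (xs x0 : 'rV[R]_d) (I : nat -> T -> 'I_n)
    (L : R) (Li : 'I_n -> R) (rho delta c gb : R) (K : nat) :
  let f := fun x => avg (fun i => fi i x) in
  let Lmax := \big[Num.max/0]_(i < n) Li i in
  let alpha := Num.min (1 / (2 * c * Lmax)) gb in
  let zeta := (gb + alpha) - rho * (gb - alpha + L * gb ^+ 2) in
  let gbar := (- (rho - 1) + Num.sqrt ((rho - 1) ^+ 2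
                 + 4 * L * rho * (rho + 1) / (2 * c * Lmax))) / (2 * L * rho) in
  (0 < n)%N -> (0 < K)%N ->
  (forall x, f xs <= f x) ->
  avgE (fun i => (fi i xs)%:E - infval (fi i))%E \is a fin_num ->
  0 < L -> 0 < Lmax ->
  smooth L f -> (forall i, smooth (Li i) (fi i)) ->
  0 < rho -> 0 < delta ->
  (forall x, avg (fun i => enorm (grad (fi i) x) ^+ 2)
             <= rho * enorm (grad f x) ^+ 2 + delta) ->
  0 < c -> 0 < gb ->
  rho * L / (4 * Lmax) < c ->
  gb < Num.min (2 / (L * rho)) gbar ->
  iid_uniform P I ->
  (\big[Order.min/+oo]_(k < K)
      'E_P[fun w =>
             (enorm (grad f (sgd_sps c gb fi x0 (fun j => I j w) k)) ^+ 2)%R]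
   <= (2 / (zeta * K%:R) * (f x0 - f xs)
       + (gb - alpha + L * gb ^+ 2) * delta / zeta)%:E)%E.
Proof.
move=> f Lmax alpha zeta gbar n0 K0 fmin avgfin L0 Lmax0 Lf Lfi rho0 _ growth.
move=> c0 gb0 _; rewrite lt_min => /andP[gb1 gb2] iid.
have fifin := infval_fin_num n0 avgfin.
have Mfi i : smooth Lmax (fi i) by apply: smooth_le (Lfi i); exact: le_bigmax.
have zeta0 : 0 < zeta.
  apply: zeta_gt0 => //; first by rewrite divr_gt0 ?mulr_gt0.
  by rewrite mul1r.
have descent x := sps_expected_descent n0 L0 Lmax0 c0 gb0 Lf Mfi fifin (growth x).
have [k kle] := mean_min_le x0 n0 K0 zeta0 fmin descent.
apply/bigmin_leP; right; exists k => //.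
under [X in ('E_P[X])%E]eq_fun do rewrite sgd_spsE.
rewrite (expectation_iterated iid _ x0 k (F := fun x => enorm (grad f x) ^+ 2)) //.
by move=> x; exact: sqr_ge0.
Qed.
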